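(* Let $n\ge 2$, let $X_1,\dots,X_n$ be complex Banach spaces, and let $D_1\in\mathcal{B}(X_1),\ D_2\in\mathcal{B}(X_2),\dots,D_n\in\mathcal{B}(X_n)$. Assume that $D_s$ is regular for every $2\le s\le n-1$. Consider the following statements: (i) (a) $D_1\in\mathcal{G}_l(X_1)$; and (b) $D_n$ is regular and $\mathcal{N}(D_i)\preceq\mathcal{K}(D_{i-1})$ for every $2\le i\le n$; (ii) there exists $A\in\mathcal{B}_n$ such that $T_n^d(A)\in\mathcal{G}_l(X_1\oplus\cdots\oplus X_n)$; (iii) (a) $D_1\in\mathcal{G}_l(X_1)$; and (b) for every $2\le i\le n$, the relation $\bigoplus_{s=1}^{i-1}\mathcal{K}(D_s)\prec\mathcal{N}(D_i)$ does not hold. Then (i) implies (ii). If moreover $X_1,\dots,X_n$ are infinite dimensional Hilbert spaces, then (ii) implies (iii).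
   Context: For Banach spaces $X,Y$, $\mathcal{B}(X,Y)$ is the set of bounded linear operators from $X$ to $Y$, and $\mathcal{B}(X)=\mathcal{B}(X,X)$. $\mathcal{N}(T)$ and $\mathcal{R}(T)$ denote the kernel and the range of $T$. No separability is assumed. Given $D_i\in\mathcal{B}(X_i)$, $1\le i\le n$, let $\mathcal{B}_n$ be the set of all tuples $A=(A_{ij})_{1\le i<j\le n}$ with $A_{ij}\in\mathcal{B}(X_j,X_i)$. For $A\in\mathcal{B}_n$, $T_n^d(A)\in\mathcal{B}(X_1\oplus\cdots\oplus X_n)$ is the upper triangular $n\times n$ operator matrix with diagonal entries $D_1,\dots,D_n$, with $(i,j)$ entry $A_{ij}$ for $i<j$, and with $(i,j)$ entry $0$ for $i>j$. An operator $T\in\mathcal{B}(X,Y)$ is left invertible if $ST=I$ for some $S\in\mathcal{B}(Y,X)$. $\mathcal{G}_l(X)$ is the set of left invertible operators in $\mathcal{B}(X)$. $T\in\mathcal{B}(X)$ is (inner) regular if $T=T\widetilde{T}T$ for some $\widetilde{T}\in\mathcal{B}(X)$; equivalently, $\mathcal{N}(T)$ and $\mathcal{R}(T)$ are closed and complemented subspaces of $X$. For $T\in\mathcal{B}(X)$ such that $\overline{\mathcal{R}(T)}$ is complemented in $X$, $\mathcal{K}(T)$ denotes a topological complement of $\overline{\mathcal{R}(T)}$ in $X$ (unique up to isomorphism; in a Hilbert space one may take $\mathcal{R}(T)^\perp$). For Banach spaces $X,Y$, write $X\preceq Y$ if there is a left invertible operator from $X$ to $Y$. Write $X\prec Y$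 if $X\preceq Y$ and $Y/\mathcal{R}(T)$ is an infinite dimensional linear space for every $T\in\mathcal{B}(X,Y)$. (If $X,Y$ are Hilbert spaces, then $X\preceq Y$ iff $\dim X\le\dim Y$, and $X\prec Y$ iff $\dim X<\dim Y$ and $\dim Y=\infty$, where $\dim$ is the orthogonal dimension.) *)

(* Defs.v *)
From HB Require Import structures.
From mathcomp Require Import all_boot all_order all_algebra.
From mathcomp Require Import ring_quotient sesquilinear complex.
From mathcomp Require Import boolp classical_sets functions reals.
From mathcomp Require Import topology normedtype.

Set Implicit Arguments.
Unset Strict Implicit.
Unset Printing Implicit Defensive.

Import Order.TTheory GRing.Theory Num.Theory.
Import numFieldNormedType.Exports.

Local Open Scope classical_set_scope.
Local Open Scope quotient_scope.
Local Open Scope ring_scope.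

HB.mixin Record isBoundedOp (K : numFieldType) (X Y : normedModType K)
    (f : X -> Y) := {
  boundedOp_near0 : bounded_near f (nbhs (0 : X))
}.

#[short(type="boundedOp")]
HB.structure Definition BoundedOp (K : numFieldType) (X Y : normedModType K) :=
  {f of @isBoundedOp K X Y f & @GRing.Linear K X Y *:%R f}.

Notation "''B' ( X , Y )" := (boundedOp X Y)
  (at level 8, X at level 99, Y at level 99,
   format "''B' ( X ,  Y )") : type_scope.

Lemma boundedOp_continuous (K : numFieldType) (X Y : normedModType K)
  (f : 'B(X, Y)) : continuous f.
Proof. exact/bounded_linear_continuous/boundedOp_near0. Qed.

Section Operators.
Variables (K : numFieldType) (X Y : normedModType K).

Definition left_invertible (T : 'B(X, Y)) :=
  exists S : 'B(Y, X), cancel T S.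

Definition regular (T : 'B(X, X)) :=
  exists S : 'B(X, X), forall x, T x = T (S (T x)).

End Operators.

Record closedSubspace (K : numFieldType) (X : normedModType K) :=
  ClosedSubspace {
    cs_pred : {pred X};
    cs_submod : submod_closed cs_pred;
    cs_closed : closed [set` cs_pred]
  }.

HB.instance Definition _ (K : numFieldType) (X : normedModType K)
  (M : closedSubspace X) :=
  GRing.isSubmodClosed.Build K X (cs_pred M) (cs_submod M).

Record cs_type (K : numFieldType) (X : normedModType K)
  (M : closedSubspace X) := CsType { cs_val : X; _ : cs_val \in cs_pred M }.
Arguments cs_val {K X M}.

Coercion cs_type : closedSubspace >-> Sortclass.

Section ClosedSubspaceNormed.
Variables (K : numFieldType) (X : normedModType K) (M : closedSubspace X).

HB.instance Definition _ := [isSub for @cs_val K X M].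
HB.instance Definition _ := [Choice of cs_type M by <:].
HB.instance Definition _ := [SubChoice_isSubLmodule of cs_type M by <:].

Let cs_norm (x : cs_type M) : K := `|cs_val x|.

Let cs_ler_normD x y : cs_norm (x + y) <= cs_norm x + cs_norm y.
Proof. exact: ler_normD. Qed.

Let cs_normrZ (l : K) x : cs_norm (l *: x) = `|l| * cs_norm x.
Proof. exact: normrZ. Qed.

Let cs_normr0_eq0 x : cs_norm x = 0 -> x = 0.
Proof. by move=> /normr0_eq0 x0; exact: val_inj. Qed.

HB.instance Definition _ :=
  Lmodule_isNormed.Build K (cs_type M) cs_ler_normD cs_normrZ cs_normr0_eq0.

Lemma cs_normE (x : cs_type M) : `|x| = `|cs_val x|.
Proof. by []. Qed.

End ClosedSubspaceNormed.

Section ClosedSubspaceComplete.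
Variables (K : numFieldType) (X : completeNormedModType K).
Variable M : closedSubspace X.

Let cs_complete (F : set_system (cs_type M)) :
  ProperFilter F -> cauchy F -> cvg F.
Proof.
move=> FF /cauchy_ballP Fc.
have vc : cauchy (@cs_val K X M @ F).
  apply/cauchy_ballP => e e0; have := Fc e e0.
  rewrite !near_simpl => -[[A B] /= [FA FB] AB].
  exists (@cs_val K X M @` A, @cs_val K X M @` B) => /=.
    by split; [apply: filterS FA|apply: filterS FB] => x Ax; exists x.
  move=> [_ _] /= [[a Aa <-] [b Bb <-]].
  by have := AB (a, b) (conj Aa Bb); rewrite /= -!ball_normE.
have /cauchy_cvgP/cvg_ex[l vl] := vc.
have Ml : l \in cs_pred M.
  suff : [set` cs_pred M] l by [].
  apply: (closed_cvg _ (@cs_closed K X M) _ _ vl).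
  by apply: nearW => -[].
apply/cvg_ex; exists (CsType Ml); apply/cvgrPdist_lt => e e0.
by have /cvgrPdist_lt/(_ e e0) := vl.
Qed.

HB.instance Definition _ := Uniform_isComplete.Build (cs_type M) cs_complete.

End ClosedSubspaceComplete.

Section Kernel.
Variables (K : numFieldType) (X Y : normedModType K) (T : 'B(X, Y)).

Let ker_pred : {pred X} := [pred x | T x == 0].

Let ker_submod : submod_closed ker_pred.
Proof.
split=> [|a x y]; rewrite !inE ?linear0 // => /eqP Tx /eqP Ty.
by rewrite linearP /= Tx Ty scaler0 addr0.
Qed.

Let ker_closed : closed [set` ker_pred].
Proof.
rewrite (_ : [set` _] = T @^-1` [set 0]).
  apply: preimage_closed; first by move=> x _; exact: boundedOp_continuous.
  by apply: accessible_closed_set1; exact/hausdorff_accessible.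
by apply/seteqP; split=> x /=; rewrite inE => /eqP.
Qed.

Definition kernel : closedSubspace X := ClosedSubspace ker_submod ker_closed.

Lemma kernelE x : (x \in cs_pred kernel) = (T x == 0).
Proof. by []. Qed.

End Kernel.

(* X is the topological direct sum of A and M: M is the kernel, and A the
   range, of a bounded projection. *)
Definition topological_complement (K : numFieldType) (X : normedModType K)
    (A : set X) (M : closedSubspace X) :=
  exists P : 'B(X, X), [/\ forall x, P (P x) = P x, range P = A &
                           forall x, (P x = 0) <-> (x \in cs_pred M)].

Definition complemented (K : numFieldType) (X : normedModType K)
    (A : set X) :=
  exists M : closedSubspace X, topological_complement A M.

(* The direct sum is given the l^1 norm, which is equivalent to every l^p
   norm, in particular to the Hilbert sum norm. *)
Definition dsum (K : numFieldType) (I : finType) (X : I -> normedModType K) :=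
  forall i, X i.

Section DirectSumNormed.
Variables (K : numFieldType) (I : finType) (X : I -> normedModType K).

HB.instance Definition _ := gen_eqMixin (dsum X).
HB.instance Definition _ := gen_choiceMixin (dsum X).

Let add (x y : dsum X) : dsum X := fun i => x i + y i.
Let opp (x : dsum X) : dsum X := fun i => - x i.
Let zero : dsum X := fun i => 0.
Let scale (a : K) (x : dsum X) : dsum X := fun i => a *: x i.

Let addA : associative add.
Proof. by move=> x y z; apply: functional_extensionality_dep => i; exact: addrA. Qed.
Let addC : commutative add.
Proof. by move=> x y; apply: functional_extensionality_dep => i; exact: addrC. Qed.
Let add0 : left_id zero add.
Proof. by move=> x; apply: functional_extensionality_dep => i; exact: add0r. Qed.
Let addN : left_inverse zero opp add.
Proof. by move=> x; apply: functional_extensionality_dep => i; exact: addNr. Qed.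

HB.instance Definition _ :=
  GRing.isZmodule.Build (dsum X) addA addC add0 addN.

Let scaleA a b (x : dsum X) : scale a (scale b x) = scale (a * b) x.
Proof. by apply: functional_extensionality_dep => i; exact: scalerA. Qed.
Let scale1 : left_id 1 scale.
Proof. by move=> x; apply: functional_extensionality_dep => i; exact: scale1r. Qed.
Let scaleDr : right_distributive scale +%R.
Proof. by move=> a x y; apply: functional_extensionality_dep => i; exact: scalerDr. Qed.
Let scaleDl (x : dsum X) : {morph scale^~ x : a b / a + b}.
Proof. by move=> a b; apply: functional_extensionality_dep => i; exact: scalerDl. Qed.

HB.instance Definition _ :=
  GRing.Zmodule_isLmodule.Build K (dsum X) scaleA scale1 scaleDr scaleDl.

Let norm (x : dsum X) : K := \sum_i `|x i|.

Let norm_D x y : norm (x + y) <= norm x + norm y.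
Proof. by rewrite -big_split; apply: ler_sum => i _; exact: ler_normD. Qed.

Let norm_Z (l : K) x : norm (l *: x) = `|l| * norm x.
Proof. by rewrite mulr_sumr; apply: eq_bigr => i _; exact: normrZ. Qed.

Let norm_eq0 x : norm x = 0 -> x = 0.
Proof.
move=> /eqP; rewrite psumr_eq0// => /allP x0.
apply: functional_extensionality_dep => i; apply/eqP; rewrite -normr_eq0.
by apply: x0; rewrite mem_index_enum.
Qed.

HB.instance Definition _ :=
  Lmodule_isNormed.Build K (dsum X) norm_D norm_Z norm_eq0.

Lemma dsum_normE (x : dsum X) : `|x| = \sum_i `|x i|.
Proof. by []. Qed.

Lemma dsum_addE (x y : dsum X) i : (x + y) i = x i + y i.
Proof. by []. Qed.

Lemma dsum_oppE (x : dsum X) i : (- x) i = - x i.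
Proof. by []. Qed.

Lemma dsum_scaleE (a : K) (x : dsum X) i : (a *: x) i = a *: x i.
Proof. by []. Qed.

Lemma dsum_norm_ge (x : dsum X) i : `|x i| <= `|x|.
Proof. by rewrite dsum_normE (bigD1 i)//= lerDl sumr_ge0. Qed.

End DirectSumNormed.

Section DirectSumComplete.
Variables (K : numFieldType) (I : finType) (X : I -> completeNormedModType K).

Let dsum_complete (F : set_system (dsum X)) :
  ProperFilter F -> cauchy F -> cvg F.
Proof.
move=> FF /cauchy_ballP Fc.
have cvgi i : cvg ((fun x : dsum X => x i) @ F).
  apply/cauchy_cvgP/cauchy_ballP => e e0; have := Fc e e0.
  rewrite !near_simpl => -[[A B] /= [FA FB] AB].
  exists ((fun x : dsum X => x i) @` A, (fun x : dsum X => x i) @` B) => /=.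
    by split; [apply: filterS FA|apply: filterS FB] => x Ax; exists x.
  move=> [_ _] /= [[a Aa <-] [b Bb <-]].
  have := AB (a, b) (conj Aa Bb); rewrite /= -!ball_normE /ball_ /=.
  by apply: le_lt_trans; exact: (dsum_norm_ge (a - b)).
apply/cvg_ex; exists ((fun i => lim ((fun x : dsum X => x i) @ F)) : dsum X).
apply/cvgrPdist_lt => e e0.
pose d := e / #|I|.+1%:R.
have d0 : 0 < d by rewrite divr_gt0.
have : \forall x \near F, forall i, `|lim ((fun x : dsum X => x i) @ F) - x i| < d.
  apply: filter_forall => i.
  by have /cvgrPdist_lt/(_ d d0) := cvgi i.
apply: filterS => x xd; rewrite dsum_normE.
apply: (@le_lt_trans _ _ (\sum_(i : I) d)).
  by apply: ler_sum => i _; exact/ltW/xd.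
rewrite sumr_const -mulr_natr /d mulrAC ltr_pdivrMr//.
by rewrite ltr_pM2l// ltr_nat.
Qed.

HB.instance Definition _ := Uniform_isComplete.Build (dsum X) dsum_complete.

End DirectSumComplete.

Definition strict_upper (K : numFieldType) (n : nat)
    (X : 'I_n -> normedModType K) :=
  forall i j : 'I_n, (i < j)%N -> 'B(X j, X i).

(* The operator matrix acting on columns x: row i of T x is
   D_i x_i + \sum_(j > i) A_ij x_j. *)
Definition utmx (K : numFieldType) (n : nat) (X : 'I_n -> normedModType K)
    (D : forall i, 'B(X i, X i)) (A : strict_upper X) (x : dsum X) : dsum X :=
  fun i => D i (x i)
    + \sum_(j : {j : 'I_n | (i < j)%N}) A i (val j) (valP j) (x (val j)).

Section UpperTriangular.
Variables (K : numFieldType) (n : nat) (X : 'I_n -> normedModType K).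
Variables (D : forall i, 'B(X i, X i)) (A : strict_upper X).

Let utmx_linear : linear (utmx D A).
Proof.
move=> a x y; apply: functional_extensionality_dep => i.
rewrite dsum_addE dsum_scaleE /utmx dsum_addE dsum_scaleE linearP.
rewrite scalerDr scaler_sumr addrACA -big_split; congr (_ + _).
by apply: eq_bigr => j _; rewrite dsum_addE dsum_scaleE linearP.
Qed.

HB.instance Definition _ :=
  GRing.isLinear.Build K (dsum X) (dsum X) *:%R (utmx D A) utmx_linear.

Let bounded_ex (Y Z : normedModType K) (f : 'B(Y, Z)) :
  exists2 r : K, 0 <= r & forall y, `|f y| <= r * `|y|.
Proof.
have /linear_boundedP/pinfty_ex_gt0[r r0 fr] := @boundedOp_near0 K Y Z f.
by exists r => //; exact: ltW.
Qed.

Let utmx_bounded : bounded_near (utmx D A) (nbhs (0 : dsum X)).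
Proof.
pose c i := projT1 (cid2 (bounded_ex (D i))).
pose b i j h := projT1 (cid2 (bounded_ex (@A i j h))).
have c0 i : 0 <= c i by rewrite /c; case: cid2.
have b0 i j h : 0 <= b i j h by rewrite /b; case: cid2.
have cP i y : `|D i y| <= c i * `|y| by rewrite /c; case: cid2.
have bP i j h y : `|@A i j h y| <= b i j h * `|y| by rewrite /b; case: cid2.
pose r := \sum_i (c i + \sum_(j : {j : 'I_n | (i < j)%N}) b i (val j) (valP j)).
have r0 : 0 <= r.
  by apply: sumr_ge0 => i _; rewrite addr_ge0// sumr_ge0.
have rP x : `|utmx D A x| <= r * `|x|.
  rewrite dsum_normE mulr_suml; apply: ler_sum => i _.
  rewrite mulrDl mulr_suml; apply: le_trans (ler_normD _ _) _.
  apply: lerD.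
    by apply: le_trans (cP _ _) _; rewrite ler_wpM2l// dsum_norm_ge.
  apply: le_trans (ler_norm_sum _ _ _) _; apply: ler_sum => j _.
  by apply: le_trans (bP _ _ _ _) _; rewrite ler_wpM2l// dsum_norm_ge.
apply/linear_boundedP; exists r; split; first exact: ger0_real.
by move=> s rs x; apply: le_trans (rP x) _; rewrite ler_wpM2r// ltW.
Qed.

HB.instance Definition _ := isBoundedOp.Build K (dsum X) (dsum X)
  (utmx D A) utmx_bounded.

Definition upper_triangular_op : 'B(dsum X, dsum X) := utmx D A.

End UpperTriangular.

Section QuotientByRange.
Variables (K : numFieldType) (X Y : normedModType K) (T : 'B(X, Y)).

Definition range_pred : {pred Y} := [pred y | y \in range T].

Let range_predP y : reflect (exists x, T x = y) (y \in range_pred).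
Proof.
apply: (iffP idP) => [/set_mem[x _ <-]|[x <-]]; first by exists x.
by apply: mem_set; exists x.
Qed.

Let range_submod : submod_closed range_pred.
Proof.
split=> [|a _ _ /range_predP[u <-] /range_predP[v <-]]; apply/range_predP.
  by exists 0; rewrite linear0.
by exists (a *: u + v); rewrite linearP.
Qed.

HB.instance Definition _ :=
  GRing.isSubmodClosed.Build K Y range_pred range_submod.

Definition quot_range := Quotient.quot range_pred.

HB.instance Definition _ := GRing.Zmodule.on quot_range.

Let scale (a : K) (q : quot_range) : quot_range :=
  \pi_quot_range (a *: repr q).

Let pi_eq (x y : Y) : x - y \in range_pred ->
  \pi_quot_range x = \pi_quot_range y.
Proof. by move=> xy; apply/eqP; rewrite -Quotient.idealrBE. Qed.

Let pi_scale a y : scale a (\pi_quot_range y) = \pi_quot_range (a *: y).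
Proof.
rewrite /scale; apply: pi_eq; rewrite -scalerBr rpredZ//.
by rewrite Quotient.idealrBE reprK.
Qed.

Let pi_D x y :
  \pi_quot_range (x + y) = \pi_quot_range x + \pi_quot_range y.
Proof. exact: Quotient.pi_add. Qed.

Let pi_surj q : exists y, q = \pi_quot_range y.
Proof. by exists (repr q); rewrite reprK. Qed.

Let scaleA a b q : scale a (scale b q) = scale (a * b) q.
Proof. by have [y ->] := pi_surj q; rewrite !pi_scale scalerA. Qed.
Let scale1 : left_id 1 scale.
Proof. by move=> q; have [y ->] := pi_surj q; rewrite pi_scale scale1r. Qed.
Let scaleDr : right_distributive scale +%R.
Proof.
move=> a p q; have [x ->] := pi_surj p; have [y ->] := pi_surj q.
by rewrite -pi_D !pi_scale scalerDr pi_D.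
Qed.
Let scaleDl q : {morph scale^~ q : a b / a + b}.
Proof.
by move=> a b; have [y ->] := pi_surj q; rewrite !pi_scale scalerDl pi_D.
Qed.

HB.instance Definition _ :=
  GRing.Zmodule_isLmodule.Build K quot_range scaleA scale1 scaleDr scaleDl.

Definition quot_class (y : Y) : quot_range := \pi_quot_range y.

Lemma quot_class_surj (q : quot_range) : exists y, q = quot_class y.
Proof. exact: pi_surj. Qed.

Lemma quot_classZ a y : quot_class (a *: y) = a *: quot_class y.
Proof. by symmetry; exact: pi_scale. Qed.

Lemma quot_classD x y : quot_class (x + y) = quot_class x + quot_class y.
Proof. exact: pi_D. Qed.

Lemma quot_classP x y : quot_class x = quot_class y <-> range T (x - y).
Proof.
split=> [/eqP|xy]; first by rewrite -Quotient.idealrBE => /set_mem.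
by apply: pi_eq; exact: mem_set.
Qed.

End QuotientByRange.

Definition infinite_dim (K : numFieldType) (V : lmodType K) :=
  ~ exists (m : nat) (e : 'I_m -> V),
      forall v, exists c : 'I_m -> K, v = \sum_i c i *: e i.

Definition preceq (K : numFieldType) (X Y : normedModType K) :=
  exists T : 'B(X, Y), left_invertible T.

Definition prec (K : numFieldType) (X Y : normedModType K) :=
  preceq X Y /\ forall T : 'B(X, Y), infinite_dim (quot_range T).

(* The norm comes from an inner product; completeness is carried by the type
   of X. *)
Definition is_hilbert (C : numClosedFieldType) (X : completeNormedModType C) :=
  exists dot : {dot X for Num.conj}, forall x, `|x| ^+ 2 = dot x x.

(* Main.v *)
(* (i) => (ii): let G_j be a generalized inverse of D_j, so that 1 - G_j D_j
   projects onto N(D_j), and let J_j embed N(D_j) into K(D_{j-1}) with left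
   inverse S_j.  The only nonzero off-diagonal entries are taken to be
   A_{j-1,j} = J_j (1 - G_j D_j).  Row j-1 of T x then splits along
   R(D_{j-1}) + K(D_{j-1}): the first part gives D_{j-1} x_{j-1}, the second
   gives, through S_j, the component of x_j in N(D_j).

   (ii) => (iii): let S be a left inverse of T.  For w in N(D_i), the vector
   T(0,..,0,w,0,..) is supported on the rows s < i; peeling off rows from the
   bottom, any such vector has the form T x + k with x supported on s < i and
   k in the sum of the K(D_s), s < i.  Applying S and reading coordinate i gives
   w = (S k)_i.  Followed by the orthogonal projection onto N(D_i), the map
   k |-> (S k)_i is therefore a bounded surjection from the sum of the K(D_s)
   onto N(D_i), whose quotient is zero. *)

Require Import Defs.
From HB Require Import structures.
From mathcomp Require Import all_boot all_order all_algebra complex.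
From mathcomp Require Import sesquilinear ring lra.
From mathcomp Require Import boolp classical_sets functions reals.
From mathcomp Require Import topology normedtype.

Set Implicit Arguments.
Unset Strict Implicit.
Unset Printing Implicit Defensive.

Import Order.TTheory GRing.Theory Num.Theory.
Import numFieldNormedType.Exports.

Local Open Scope classical_set_scope.
Local Open Scope ring_scope.

(** * Bounded operators built from plain functions *)

(** Boundedness is a property of the bare function, so an explicit formula can be checked piece by
    piece with the closure lemmas below. Destructing the proof then yields a bundled operator with
    that formula. *)
Definition bounded_operator (K : numFieldType) (X Y : normedModType K)
  (f : X -> Y) := exists g : 'B(X, Y), g =1 f.

Lemma boundedOp_le {K : numFieldType} {X Y : normedModType K} (f : 'B(X, Y)) :
  exists2 r : K, 0 <= r & forall x, `|f x| <= r * `|x|.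
Proof.
have /linear_boundedP/pinfty_ex_gt0[r r0 fr] := @boundedOp_near0 K X Y f.
by exists r => //; exact: ltW.
Qed.

Lemma bounded_operatorP (K : numFieldType) (X Y : normedModType K)
  (f : X -> Y) (r : K) : linear f -> 0 <= r ->
  (forall x, `|f x| <= r * `|x|) -> bounded_operator f.
Proof.
move=> lf r0 fr.
pose lfM := GRing.isLinear.Build K X Y *:%R f lf.
pose F : {linear X -> Y} := HB.pack f lfM.
have bF : bounded_near F (nbhs (0 : X)).
  apply/linear_boundedP; exists r; split; first exact: ger0_real.
  by move=> s rs x; apply: le_trans (fr x) _; rewrite ler_wpM2r// ltW.
pose bM := isBoundedOp.Build K X Y F bF.
by exists (HB.pack_for 'B(X, Y) f lfM bM).
Qed.

Section BoundedOperators.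
Context {K : numFieldType}.
Implicit Types X Y Z : normedModType K.

Lemma bounded_operator_op X Y (f : 'B(X, Y)) : bounded_operator f.
Proof. by exists f. Qed.

Lemma bounded_operator_id X : bounded_operator (fun x : X => x).
Proof.
by apply: (@bounded_operatorP _ _ _ _ 1) => // x; rewrite mul1r.
Qed.

Lemma bounded_operator0 X Y : bounded_operator (fun _ : X => 0 : Y).
Proof.
apply: (@bounded_operatorP _ _ _ _ 0) => // [a x y|x].
  by rewrite scaler0 addr0.
by rewrite normr0 mul0r.
Qed.

Lemma bounded_operator_comp X Y Z (f : Y -> Z) (g : X -> Y) :
  bounded_operator f -> bounded_operator g ->
  bounded_operator (fun x => f (g x)).
Proof.
move=> [F Ff] [G Gg].
have [r r0 Fr] := boundedOp_le F; have [s s0 Gs] := boundedOp_le G.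
apply: (@bounded_operatorP _ _ _ _ (r * s)) => [a x y||x]; rewrite ?mulr_ge0//.
  by rewrite -!Gg -!Ff !linearP.
rewrite -Gg -Ff -mulrA; apply: le_trans (Fr _) _.
by rewrite ler_wpM2l.
Qed.

Lemma bounded_operatorD X Y (f g : X -> Y) :
  bounded_operator f -> bounded_operator g ->
  bounded_operator (fun x => f x + g x).
Proof.
move=> [F Ff] [G Gg].
have [r r0 Fr] := boundedOp_le F; have [s s0 Gs] := boundedOp_le G.
apply: (@bounded_operatorP _ _ _ _ (r + s)) => [a x y||x]; rewrite ?addr_ge0//.
  by rewrite -!Gg -!Ff !linearP scalerDr addrACA.
rewrite -Gg -Ff mulrDl; apply: le_trans (ler_normD _ _) _.
exact: lerD.
Qed.

Lemma bounded_operatorN X Y (f : X -> Y) :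
  bounded_operator f -> bounded_operator (fun x => - f x).
Proof.
move=> [F Ff]; have [r r0 Fr] := boundedOp_le F.
apply: (@bounded_operatorP _ _ _ _ r) => // [a x y|x].
  by rewrite -!Ff linearP opprD scalerN.
by rewrite -Ff normrN.
Qed.

Lemma bounded_operator_sum X Y (I : Type) (s : seq I) (f : I -> X -> Y) :
  (forall i, bounded_operator (f i)) ->
  bounded_operator (fun x => \sum_(i <- s) f i x).
Proof.
move=> bf; elim: s => [|i s IHs].
  by rewrite (_ : (fun _ => _) = fun=> 0)//;
    [exact: bounded_operator0|apply/funext => x; rewrite big_nil].
rewrite (_ : (fun _ => _) = fun x => f i x + \sum_(j <- s) f j x).
  exact: bounded_operatorD.
by apply/funext => x; rewrite big_cons.
Qed.

Lemma bounded_operator_coord {I : finType} (X : I -> normedModType K) i :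
  bounded_operator (fun x : dsum X => x i).
Proof.
apply: (@bounded_operatorP _ _ _ _ 1) => // x.
by rewrite mul1r dsum_norm_ge.
Qed.

Lemma bounded_operator_dsum {I : finType} X (Y : I -> normedModType K)
  (f : forall i, X -> Y i) :
  (forall i, bounded_operator (f i)) ->
  bounded_operator (fun x : X => (fun i => f i x) : dsum Y).
Proof.
move=> bf; have bd i : exists r : K, 0 <= r /\ forall x, `|f i x| <= r * `|x|.
  have [g gf] := bf i; have [r r0 gr] := boundedOp_le g.
  by exists r; split=> // x; rewrite -gf.
have [r rP] := choice bd.
apply: (@bounded_operatorP _ _ _ _ (\sum_i r i)).
- move=> a x y; apply: functional_extensionality_dep => i.
  by have [g gf] := bf i; rewrite dsum_addE dsum_scaleE -!gf linearP.
- by apply: sumr_ge0 => i _; have [] := rP i.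
move=> x; rewrite dsum_normE mulr_suml; apply: ler_sum => i _.
by have [] := rP i.
Qed.

Definition dsum_inj {I : finType} (X : I -> normedModType K) (i : I)
  (x : X i) : dsum X := @dfwith I X (fun j => 0 : X j) i x.

Lemma dsum_inj_in {I : finType} (X : I -> normedModType K) (i : I) (x : X i) :
  dsum_inj x i = x.
Proof. exact: dfwith_in. Qed.

Lemma dsum_inj_out {I : finType} (X : I -> normedModType K) (i j : I)
  (x : X i) : i != j -> dsum_inj x j = 0.
Proof. exact: dfwith_out. Qed.

Lemma bounded_operator_inj {I : finType} (X : I -> normedModType K) i :
  bounded_operator (@dsum_inj I X i).
Proof.
apply: bounded_operator_dsum => j; case: (eqVneq i j) => [<-|ij].
  rewrite (_ : (fun _ => _) = id); first exact: bounded_operator_id.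
  by apply/funext => x; exact: dsum_inj_in.
rewrite (_ : (fun _ => _) = fun=> 0); first exact: bounded_operator0.
by apply/funext => x; exact: dsum_inj_out.
Qed.

Lemma dsum_sumE {I : finType} (X : I -> normedModType K) (J : Type)
  (s : seq J) (P : pred J) (f : J -> dsum X) i :
  (\sum_(j <- s | P j) f j) i = \sum_(j <- s | P j) f j i.
Proof. by elim/big_rec2: _ => // j x y _ <-. Qed.

Lemma bounded_operator_val X (M : closedSubspace X) :
  bounded_operator (@cs_val K X M).
Proof.
by apply: (@bounded_operatorP _ _ _ _ 1) => // x; rewrite mul1r -cs_normE.
Qed.

Lemma bounded_operator_corestr X Y (M : closedSubspace Y) (f : X -> Y)
  (fM : forall x, f x \in cs_pred M) :
  bounded_operator f -> bounded_operator (fun x => CsType (fM x)).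
Proof.
move=> [g gf]; have [r r0 gr] := boundedOp_le g.
apply: (@bounded_operatorP _ _ _ _ r) => // [a x y|x].
  by apply: val_inj; rewrite /= -!gf linearP.
by rewrite cs_normE /= -gf.
Qed.

End BoundedOperators.

(** * Ranges of regular operators *)

Section RegularOperators.
Variables (K : numFieldType) (X : normedModType K).
Implicit Types (T : 'B(X, X)) (M : closedSubspace X).

Lemma left_invertible_regular T : left_invertible T -> regular T.
Proof. by move=> [S TS]; exists S => x; rewrite TS. Qed.

(** If [T S T = T], then [T S] is a bounded projection onto the range of [T]. The range is also the
    kernel of [1 - T S], hence closed, so the closure in the hypothesis disappears. Its premise is
    met by the kernel of [T S]. *)
Lemma regular_topological_complement T M : regular T ->
  (complemented (closure (range T)) ->
    topological_complement (closure (range T)) M) ->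
  topological_complement (range T) M.
Proof.
move=> [S TST] hM.
have [P PE] : bounded_operator (fun x => T (S x)).
  by apply: bounded_operator_comp; exact: bounded_operator_op.
have [Q QE] : bounded_operator (fun x => x - T (S x)).
  apply: bounded_operatorD; first exact: bounded_operator_id.
  by apply: bounded_operatorN; exists P.
have rP : range P = range T.
  apply/seteqP; split=> _ [x _ <-]; first by exists (S x) => //; rewrite PE.
  by exists (T x) => //; rewrite PE -TST.
have rT : closure (range T) = range T.
  suff -> : range T = [set` cs_pred (kernel Q)].
    by apply/esym/closure_id; exact: cs_closed.
  apply/seteqP; split=> [_ [x _ <-]|y /=]; rewrite /= kernelE QE.
    by rewrite -TST subrr.
  by rewrite subr_eq0 => /eqP ->; exists (S y).
rewrite rT in hM; apply: hM; exists (kernel P), P; split=> // x.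
  by rewrite !PE -TST.
by rewrite kernelE; split=> [->|/eqP].
Qed.

End RegularOperators.

(** * Construction of a left invertible completion *)

Section LeftInvertibleCompletion.
Variables (K : numFieldType) (n : nat) (X : 'I_n.+1 -> normedModType K).
Variables (D : forall i, 'B(X i, X i)) (M : forall i, closedSubspace (X i)).

Lemma left_invertible_completion :
  left_invertible (D ord0) ->
  (forall i, regular (D i)) ->
  (forall i, topological_complement (range (D i)) (M i)) ->
  (forall i j : 'I_n.+1, i = j.+1 :> nat -> preceq (kernel (D i)) (M j)) ->
  exists A : strict_upper X, left_invertible (upper_triangular_op D A).
Proof.
move=> [L DL] hreg hM hle.
(* [Q i] is the projection onto the range of [D i] along [M i]. *)
have [Q QP] : {Q : forall i, 'B(X i, X i) |
    forall i, (forall x, Q i (D i x) = D i x) /\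
      (forall x, Q i x \in range (D i)) /\
      (forall x, Q i x = 0 <-> x \in cs_pred (M i))}.
  suff H i : {Q : 'B(X i, X i) | (forall x, Q (D i x) = D i x) /\
      (forall x, Q x \in range (D i)) /\
      (forall x, Q x = 0 <-> x \in cs_pred (M i))}.
    by exists (fun i => projT1 (H i)) => i; exact: projT2 (H i).
  apply: cid; have [Q [QQ rQ Q0]] := hM i; exists Q; split.
    move=> x; have [y _ <-] : range Q (D i x) by rewrite rQ; exists x.
    exact: QQ.
  by split=> // x; rewrite -rQ; apply: mem_set; exists x.
(* At index 0 the generalized inverse must be a true left inverse: no row lies above row 0 from
   which a kernel component of [x ord0] could be recovered. *)
have [G GP] : {G : forall i, 'B(X i, X i) |
    (forall i x, D i x = D i (G i (D i x))) /\ forall x, G ord0 (D ord0 x) = x}.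
  suff H i : {G : 'B(X i, X i) | (forall x, D i x = D i (G (D i x))) /\
      (i = ord0 -> forall x, G (D i x) = x)}.
    exists (fun i => projT1 (H i)); split=> [i|]; first by case: (projT2 (H i)).
    by case: (projT2 (H ord0)) => _; apply.
  apply: cid; have [->|i0] := eqVneq i ord0.
    by exists L; split=> [x|_ x]; rewrite DL.
  by have [G DG] := hreg i; exists G; split=> // /eqP; rewrite (negPf i0).
have [DG G0] := GP.
(* B is the entry A_ij, and C recovers the N(D_j)-component of x_j from row i
   of T x; both vanish off the superdiagonal. *)
have pair i j : exists BC : 'B(X j, X i) * 'B(X i, X j),
    [/\ forall x, Q i (BC.1 x) = 0, forall x, BC.2 (D i x) = 0,
      (j = i.+1 :> nat -> forall x, BC.2 (BC.1 x) = x - G j (D j x)) &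
      (j <> i.+1 :> nat -> (forall x, BC.1 x = 0) /\ forall y, BC.2 y = 0)].
  have [jE|jN] := eqVneq (j : nat) i.+1; last first.
    have [B0 B0E] := bounded_operator0 (X j) (X i).
    have [C0 C0E] := bounded_operator0 (X i) (X j).
    exists (B0, C0); split=> [x|x|/eqP|_] //=; rewrite ?C0E//.
      by rewrite B0E linear0.
    by rewrite (negPf jN).
  have [J [S JS]] := hle _ _ jE.
  have Pker x : x - G j (D j x) \in cs_pred (kernel (D j)).
    by rewrite kernelE linearB /= -DG subrr.
  have QM y : y - Q i y \in cs_pred (M i).
    have [QD [Qr Q0]] := QP i; apply/Q0.
    by have /set_mem[z _ zE] := Qr y; rewrite linearB /= -zE QD subrr.
  have [B BE] : bounded_operator (fun x => cs_val (J (CsType (Pker x)))).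
    apply: bounded_operator_comp; first exact: bounded_operator_val.
    apply: bounded_operator_comp; first exact: bounded_operator_op.
    apply: bounded_operator_corestr; apply: bounded_operatorD.
      exact: bounded_operator_id.
    apply: bounded_operatorN.
    by apply: bounded_operator_comp; exact: bounded_operator_op.
  have [C CE] : bounded_operator (fun y => cs_val (S (CsType (QM y)))).
    apply: bounded_operator_comp; first exact: bounded_operator_val.
    apply: bounded_operator_comp; first exact: bounded_operator_op.
    apply: bounded_operator_corestr; apply: bounded_operatorD.
      exact: bounded_operator_id.
    by apply: bounded_operatorN; exact: bounded_operator_op.
  have [QD [Qr Q0]] := QP i.
  have QB x : Q i (B x) = 0 by rewrite BE; apply/Q0; exact: valP.
  exists (B, C); split=> //= [x|_ x].
    rewrite CE (_ : CsType _ = 0) ?linear0//.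
    by apply: val_inj; rewrite /= QD subrr.
  rewrite CE (_ : CsType _ = J (CsType (Pker x))) ?JS//.
  by apply: val_inj; rewrite /= QB subr0 BE.
pose BC i j := projT1 (cid (pair i j)).
have BCP i j : [/\ forall x, Q i ((BC i j).1 x) = 0,
      forall x, (BC i j).2 (D i x) = 0,
      (j = i.+1 :> nat ->
        forall x, (BC i j).2 ((BC i j).1 x) = x - G j (D j x)) &
      (j <> i.+1 :> nat ->
        (forall x, (BC i j).1 x = 0) /\ forall y, (BC i j).2 y = 0)].
  by rewrite /BC; case: cid.
exists (fun i j _ => (BC i j).1).
(* On [y = T x], the first term gives [G j (D j (x j))], and the sum supplies the missing part
   [x j - G j (D j (x j))] from row [j - 1]. *)
have [S SE] : bounded_operator (fun y : dsum X =>
    (fun j => G j (Q j (y j)) + \sum_i (BC i j).2 (y i)) : dsum X).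
  apply: bounded_operator_dsum => j; apply: bounded_operatorD.
    apply: bounded_operator_comp; first exact: bounded_operator_op.
    apply: bounded_operator_comp; first exact: bounded_operator_op.
    exact: bounded_operator_coord.
  apply: bounded_operator_sum => i.
  apply: bounded_operator_comp; first exact: bounded_operator_op.
  exact: bounded_operator_coord.
exists S => x; rewrite SE; apply: functional_extensionality_dep => j.
rewrite /= /utmx.
have QT i : Q i (D i (x i) + \sum_(k : {k : 'I_n.+1 | (i < k)%N})
    (BC i (val k)).1 (x (val k))) = D i (x i).
  have [QD _] := QP i; rewrite linearD /= QD linear_sum big1 ?addr0//= => k _.
  by have [-> _ _ _] := BCP i (val k).
rewrite QT.
have CT i : (BC i j).2 (D i (x i) + \sum_(k : {k : 'I_n.+1 | (i < k)%N})
    (BC i (val k)).1 (x (val k))) =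
    if j == i.+1 :> nat then x j - G j (D j (x j)) else 0.
  have [_ CD CB CN] := BCP i j; case: eqP => [ji|/CN[_ ->]//].
  have ij : (i < j)%N by rewrite ji.
  rewrite linearD /= CD add0r linear_sum (bigD1 (exist _ j ij))//= CB//.
  rewrite big1 ?addr0// => k kj; have [_ _ _ BN] := BCP i (val k).
  have [|-> _] := BN; last by rewrite linear0.
  move=> ki; move/eqP: kj; apply; apply: val_inj; apply: val_inj => /=.
  by rewrite ji.
under eq_bigr do rewrite CT.
(* Only [i = j - 1] contributes to the sum. For [j = 0] the sum is zero, and [G0] alone recovers the
   coordinate. *)
have [j0|j0] := posnP j.
  have -> : j = ord0 by apply: val_inj.
  by rewrite G0 big1 ?addr0.
have jn : (j.-1 < n.+1)%N by rewrite (leq_ltn_trans (leq_pred _)).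
rewrite (bigD1 (Ordinal jn))//= prednK// eqxx big1 ?addr0.
  by rewrite addrC subrK.
move=> i ij; case: eqP => // ji; case/eqP: ij; apply: val_inj.
by rewrite /= ji.
Qed.

End LeftInvertibleCompletion.

(** * Orthogonal projection onto a closed subspace of a Hilbert space *)

Section HilbertProjection.
Variables (R : realType) (X : completeNormedModType R[i]).
Variable dot : {dot X for Num.conj}.
Hypothesis dotE : forall x, `|x| ^+ 2 = dot x x.
Variable M : closedSubspace X.
Implicit Types x y z : X.

(** The norm takes values in [R[i]]; its real part lives in [R], where infima exist and [lra] and
    [nra] apply. *)
Let f x : R := complex.Re `|x|.

Let fE x : `|x| = (f x)%:C%C.
Proof. by rewrite RRe_real ?ger0_real. Qed.

Let f_ge0 x : 0 <= f x.
Proof. by rewrite -ler0c -fE. Qed.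

Let f_leD x y : f (x + y) <= f x + f y.
Proof. by rewrite -lecR rmorphD /= -!fE ler_normD. Qed.

Let f_parallelogram x y :
  f (x + y) ^+ 2 + f (x - y) ^+ 2 = 2 * f x ^+ 2 + 2 * f y ^+ 2.
Proof.
have sqE z : dot z z = (f z ^+ 2)%:C%C by rewrite -dotE fE rmorphXn.
apply: complexI; rewrite rmorphD [RHS]rmorphD !(rmorphM _ 2) rmorph_nat /=.
rewrite -!sqE.
rewrite dnormD dnormB addrACA subrr addr0 !mulr_natl !mulr2n.
by rewrite addrACA.
Qed.

Let f_double x : f (x + x) = 2 * f x.
Proof.
apply: complexI; rewrite rmorphM rmorph_nat /= -!fE.
by rewrite -mulr2n -scaler_nat normrZ normr_nat.
Qed.

(** By the parallelogram law near-minimizers of the distance are close to each other, so they form a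
    Cauchy filter on [M]. Its limit, given by completeness of [M], attains the infimum. *)
Lemma best_approximation x : exists2 m, m \in cs_pred M &
  forall z, z \in cs_pred M -> `|x - m| <= `|x - z|.
Proof.
pose E := [set f (x - z) | z in [set` cs_pred M]].
pose d := inf E.
have E0 : E !=set0 by exists (f (x - 0)), 0 => //=; exact: rpred0.
have lbE : has_lbound E by exists 0 => _ [z _ <-].
have dle z : z \in cs_pred M -> d <= f (x - z).
  by move=> zM; apply: ge_inf => //; exists z.
have dlt e : 0 < e -> exists2 z, z \in cs_pred M & f (x - z) < d + e.
  move=> e0; have [_ [z zM <-] ze] := inf_adherent e0 (conj E0 lbE).
  by exists z.
have d0 : 0 <= d by apply: lb_le_inf => // _ [z _ <-].
(* The midpoint [w] of [u] and [v] lies in [M], so [d <= f (x - w)]. The parallelogram law for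
   [x - u] and [x - v] then bounds [f (u - v) ^+ 2] by [4 (d + e)^2 - 4 d^2], which is the stated
   bound. *)
have close e u v : 0 < e -> u \in cs_pred M -> v \in cs_pred M ->
    f (x - u) < d + e -> f (x - v) < d + e ->
    f (u - v) ^+ 2 <= 4 * e * (2 * d + e).
  move=> e0 uM vM ud vd; have := f_parallelogram (x - u) (x - v).
  have -> : x - u - (x - v) = v - u by rewrite opprB addrC addrA subrK.
  pose w := 2^-1 *: (u + v).
  have wM : w \in cs_pred M by rewrite rpredZ ?rpredD.
  have -> : x - u + (x - v) = (x - w) + (x - w).
    rewrite addrACA [RHS]addrACA; congr (_ + _); rewrite -!opprD; congr (- _).
    by rewrite -mulr2n -scaler_nat scalerA mulfV ?pnatr_eq0// scale1r.
  rewrite f_double (_ : f (v - u) = f (u - v)); last by rewrite /f distrC.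
  have := dle _ wM; have := f_ge0 (x - u); have := f_ge0 (x - v).
  set a := f (x - u) in ud *; set b := f (x - v) in vd *; set c := f (x - w).
  set g := f (u - v).
  have p1 : a ^+ 2 <= (d + e) ^+ 2 -> b ^+ 2 <= (d + e) ^+ 2 ->
    d ^+ 2 <= c ^+ 2 -> (2 * c) ^+ 2 + g ^+ 2 = 2 * a ^+ 2 + 2 * b ^+ 2 ->
    g ^+ 2 <= 4 * e * (2 * d + e) by nra.
  move=> b0 a0 dc; apply: p1.
  - by rewrite lerXn2r ?nnegrE//; lra.
  - by rewrite lerXn2r ?nnegrE//; lra.
  - by rewrite lerXn2r ?nnegrE//; lra.
pose B (e : R) := [set u : cs_type M | f (x - cs_val u) < d + e].
pose F := filter_from [set e : R | 0 < e] B.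
have FF : ProperFilter F.
  apply: filter_from_proper => [|e /dlt[z zM ze]]; last by exists (CsType zM).
  apply: filter_from_filter; first by exists 1 => /=.
  move=> e1 e2 /= e10 e20; exists (Num.min e1 e2) => /=.
    by rewrite lt_min e10.
  by move=> u; rewrite /B /= => ule; split; apply: lt_le_trans ule _;
    rewrite lerD2l ge_min lexx ?orbT.
have Fc : cauchy F.
  apply: cauchy_exP => eps eps0.
  have [r rE] : exists r : R, eps = r%:C%C.
    by exists (complex.Re eps); rewrite RRe_real ?gtr0_real.
  have r0 : 0 < r by move: eps0; rewrite rE ltcR.
  (* With [e <= 1], the bound [4 e (2 d + e)] is at most [e (8 d + 4)], which is strictly below
     [e (8 d + 8) <= r ^+ 2]. *)
  pose e := Num.min 1 (r ^+ 2 / (8 * d + 8)).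
  have d8 : 0 < 8 * d + 8 by lra.
  have e0 : 0 < e by rewrite lt_min ltr01 divr_gt0 ?exprn_gt0.
  have [z zM ze] := dlt _ e0; exists (CsType zM); exists e => //= u ue.
  rewrite -ball_normE /ball_ /= cs_normE /= fE rE ltcR.
  rewrite -(ltr_pXn2r (n := 2)) ?nnegrE ?(ltW r0)//.
  apply: le_lt_trans (close _ _ _ e0 zM (valP u) ze ue) _.
  have e1 : e <= 1 by rewrite ge_min lexx.
  have : e * (8 * d + 8) <= r ^+ 2.
    by rewrite -ler_pdivlMr// ge_min lexx orbT.
  nra.
have /cauchy_cvgP/cvg_ex[l Fl] := Fc.
exists (cs_val l) => [|z zM]; first exact: valP.
rewrite !fE lecR; apply: le_trans (dle _ zM).
apply/ler_addgt0Pr => e e0.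
have e20 : 0 < e / 2 by lra.
have /fcvgrPdist_lt/(_ (e / 2)%:C%C) := Fl.
rewrite ltcR => /(_ e20) Fe.
have Be : F (B (e / 2)) by exists (e / 2).
(* A point [u] of [M] within [e / 2] of the limit and at distance less than [d + e / 2] from [x];
   the triangle inequality concludes. *)
have [u [/= ul ud]] := filter_ex (filterI Fe Be).
have -> : x - cs_val l = x - cs_val u + (cs_val u - cs_val l).
  by rewrite addrA subrK.
apply: le_trans (f_leD _ _) _; move: ul ud.
rewrite /B /= cs_normE /= distrC fE ltcR; lra.
Qed.

(** First variation at the best approximation [m]: if [x - m] had a nonzero component along some [z]
    in [M], moving [m] by that component would bring it strictly closer to [x]. *)
Lemma orthogonal_decomposition x : exists2 m, m \in cs_pred M &
  forall z, z \in cs_pred M -> dot (x - m) z = 0.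
Proof.
have [m mM mle] := best_approximation x; exists m => // z zM.
have [->|z0] := eqVneq z 0; first exact: linear0r.
have zz0 : 0 < dot z z by rewrite dnorm_gt0.
(* [t *: z] is the projection of [x - m] on [z]. Replacing [m] by [m + t *: z] lowers the squared
   distance by [a * a^* / dot z z], so minimality forces [a = 0]. *)
set a := dot (x - m) z; pose t := a / dot z z.
have tz : m + t *: z \in cs_pred M by rewrite rpredD ?rpredZ.
have := mle _ tz; rewrite -(ler_pXn2r (n := 2)) ?nnegrE// !dotE opprD addrA.
rewrite (dnormB _ (x - m)) dnormZ linearZr_LR /= -/a.
have -> : `|t| ^+ 2 * dot z z = a * a^* / dot z z.
  rewrite /t normrM exprMn normCK normfV ger0_norm ?ltW//.
  by field; rewrite gt_eqF.
have -> : (t^* * a + (t^* * a)^*) = a * a^* / dot z z *+ 2.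
  have -> : t^* = a^* / dot z z.
    by rewrite /t rmorphM fmorphV /= (geC0_conj (ltW zz0)).
  rewrite !rmorphM fmorphV /= conjCK (geC0_conj (ltW zz0)) mulr2n.
  by congr (_ + _); rewrite mulrAC [a * _]mulrC.
rewrite mulr2n opprD addrA addrK lerBrDr gerDl -normCK pmulr_lle0 ?invr_gt0//.
by move=> a0; apply/eqP; rewrite -normr_eq0 -sqrf_eq0 eq_le a0 exprn_ge0.
Qed.

Lemma hilbert_projection : exists P : 'B(X, X),
  (forall x, P x \in cs_pred M) /\ forall x, x \in cs_pred M -> P x = x.
Proof.
have H x : exists m, m \in cs_pred M /\
    forall z, z \in cs_pred M -> dot (x - m) z = 0.
  by have [m mM mo] := orthogonal_decomposition x; exists m.
have [p pP] := choice H.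
(* The difference of two candidates lies in [M] and is orthogonal to [M], hence to itself. This
   uniqueness is what makes [p] linear. *)
have uniq_p x m : m \in cs_pred M ->
    (forall z, z \in cs_pred M -> dot (x - m) z = 0) -> p x = m.
  move=> mM mo; have [pM po] := pP x; apply/eqP; rewrite -subr_eq0.
  rewrite -(dnorm_eq0 dot).
  have -> : p x - m = x - m - (x - p x)
    by rewrite opprB [RHS]addrC addrA subrK.
  have pmM : x - m - (x - p x) \in cs_pred M.
    by rewrite opprB addrC addrA subrK rpredB.
  move: pmM; set w := (X in dot _ X) => wM.
  by rewrite linearBl /= mo// po// subrr.
have [P PE] : bounded_operator p.
  apply: (@bounded_operatorP _ _ _ _ 1) => // [a x y|x].
    have [xM xo] := pP x; have [yM yo] := pP y.
    apply: uniq_p => [|z zM]; first by rewrite rpredD ?rpredZ.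
    rewrite opprD addrACA -scalerBr linearDl /= linearZl_LR /=.
    by rewrite xo// yo// mulr0 addr0.
  have [xM xo] := pP x; rewrite mul1r.
  (* The bound 1 on [p] is Pythagoras for [x = (x - p x) + p x]. *)
  rewrite -(ler_pXn2r (n := 2)) ?nnegrE// !dotE.
  rewrite -{3 4}(subrK (p x) x) dnormD (xo (p x))// rmorph0 !addr0 lerDr.
  exact: dnorm_ge0.
exists P; split=> x; first by rewrite PE; have [] := pP x.
by move=> xM; rewrite PE; apply: uniq_p => // z _; rewrite subrr linear0l.
Qed.

End HilbertProjection.

(** The quotient is zero, so the empty family spans it. A surjection thus refutes the second clause
    of [prec]. *)
Lemma surjective_quot_range_finite_dim (K : numFieldType)
  (X Y : normedModType K) (T : 'B(X, Y)) :
  (forall y, exists x, T x = y) -> ~ infinite_dim (quot_range T).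
Proof.
move=> sT; apply; exists 0, (fun=> 0) => v; exists (fun=> 0).
have [y ->] := quot_class_surj v; rewrite big_ord0.
rewrite -(scale0r (quot_class T 0)) -quot_classZ; apply/quot_classP.
by have [x xE] := sT (y - 0 *: 0); exists x.
Qed.

(** * Consequences of left invertibility of the triangular operator *)

Section UpperTriangularLeftInverse.
Variables (K : numFieldType) (n : nat) (X : 'I_n.+1 -> normedModType K).
Variables (D : forall i, 'B(X i, X i)) (A : strict_upper X).
Let T := upper_triangular_op D A.

Lemma upper_triangular_inj_gt (i j : 'I_n.+1) (x : X j) :
  (j < i)%N -> T (dsum_inj x) i = 0.
Proof.
move=> ji; rewrite /= /utmx dsum_inj_out; last by rewrite neq_ltn ji.
rewrite linear0 add0r big1// => -[k ik] _ /=.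
rewrite dsum_inj_out ?linear0// neq_ltn.
by rewrite (ltn_trans ji ik).
Qed.

Lemma upper_triangular_inj_diag i (x : X i) : T (dsum_inj x) i = D i x.
Proof.
rewrite /= /utmx dsum_inj_in big1 ?addr0// => -[k ik] _ /=.
by rewrite dsum_inj_out ?linear0// neq_ltn ik.
Qed.

(** A vector supported on row 0 is mapped by [T] to a vector supported on row 0, where [T] acts as
    [D ord0]. The corner entry of [S] is therefore a left inverse of [D ord0]. *)
Lemma upper_triangular_left_invertible_corner :
  left_invertible T -> left_invertible (D ord0).
Proof.
move=> [S TS].
have [L LE] : bounded_operator (fun x : X ord0 => S (dsum_inj x) ord0).
  apply: (bounded_operator_comp (f := fun y : dsum X => y ord0)
    (g := fun x => S (dsum_inj x))).
    exact: bounded_operator_coord.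
  apply: bounded_operator_comp; first exact: bounded_operator_op.
  exact: bounded_operator_inj.
exists L => x; rewrite LE.
have -> : dsum_inj (D ord0 x) = T (dsum_inj x).
  apply: functional_extensionality_dep => i.
  have [->|i0] := eqVneq i ord0.
    by rewrite upper_triangular_inj_diag dsum_inj_in.
  by rewrite dsum_inj_out 1?eq_sym// upper_triangular_inj_gt// lt0n.
by rewrite TS dsum_inj_in.
Qed.

Variable M : forall i, closedSubspace (X i).

Lemma upper_triangular_complement (m : nat) (y : dsum X) : (m <= n.+1)%N ->
  (forall i : 'I_n.+1, (i < m)%N ->
    topological_complement (range (D i)) (M i)) ->
  (forall i : 'I_n.+1, (m <= i)%N -> y i = 0) ->
  exists x k : dsum X, [/\ y = T x + k,
    forall i : 'I_n.+1, (i < m)%N -> k i \in cs_pred (M i),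
    forall i : 'I_n.+1, (m <= i)%N -> x i = 0 &
    forall i : 'I_n.+1, (m <= i)%N -> k i = 0].
Proof.
elim: m y => [|m IHm] y mn hM ym.
  exists 0, 0; split=> //; rewrite linear0 addr0.
  by apply: functional_extensionality_dep => i; rewrite ym.
(* Row [i], of index [m], is the last row where [y] may be nonzero. Splitting [y i = D i u + l] and
   subtracting [T (dsum_inj u) + dsum_inj l] clears it; the rows above change, and the induction
   hypothesis takes them. *)
pose i := Ordinal mn.
have [u [l [uE lM]]] : exists u l, y i = D i u + l /\ l \in cs_pred (M i).
  have [P [PP rP P0]] := hM i (ltnSn m).
  have [u _ uE] : range (D i) (P (y i)) by rewrite -rP; exists (y i).
  exists u, (y i - P (y i)); split; first by rewrite uE addrC subrK.
  by apply/P0; rewrite linearB /= PP subrr.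
have [||x [k [yE kM xm km]]] := IHm (y - T (dsum_inj u) - dsum_inj l) (ltnW mn).
- by move=> j jm; apply: hM; rewrite ltnW.
- move=> j; rewrite leq_eqVlt => /predU1P[ij|mj].
    have <- : i = j by exact: val_inj.
    rewrite !(dsum_addE, dsum_oppE) upper_triangular_inj_diag dsum_inj_in uE.
    by rewrite (addrC (D i u)) addrK subrr.
  rewrite !(dsum_addE, dsum_oppE) upper_triangular_inj_gt//.
  by rewrite dsum_inj_out ?neq_ltn ?mj// ym// !subr0.
exists (x + dsum_inj u), (k + dsum_inj l); split.
- by rewrite linearD /= addrACA -yE addrACA subrK addNr addr0.
- move=> j; rewrite ltnS leq_eqVlt dsum_addE => /predU1P[ji|jm].
    have -> : j = i by exact: val_inj.
    by rewrite km// add0r dsum_inj_in.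
  by rewrite dsum_inj_out ?addr0 ?kM// neq_ltn jm orbT.
- move=> j mj; rewrite dsum_addE xm ?(ltnW mj)//.
  by rewrite dsum_inj_out ?addr0// neq_ltn mj.
- move=> j mj; rewrite dsum_addE km ?(ltnW mj)//.
  by rewrite dsum_inj_out ?addr0// neq_ltn mj.
Qed.

(** The Hilbert structure enters only through [P], a bounded projection onto the kernel of [D i], so
    the argument is carried out in normed spaces. *)
Lemma upper_triangular_left_invertible_not_prec (i : 'I_n.+1)
  (P : 'B(X i, X i)) :
  (forall x, P x \in cs_pred (kernel (D i))) ->
  (forall x, x \in cs_pred (kernel (D i)) -> P x = x) ->
  (forall s : 'I_n.+1, (s < i)%N ->
    topological_complement (range (D s)) (M s)) ->
  left_invertible T ->
  ~ prec (dsum (fun s : 'I_i => M (widen_ord (ltnW (ltn_ord i)) s)))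
         (kernel (D i)).
Proof.
move=> PN PK hM [S TS] [_ inf].
pose w (s : 'I_i) : 'I_n.+1 := widen_ord (ltnW (ltn_ord i)) s.
(* Extension by zero to the rows from [i] on. *)
pose emb (k : dsum (fun s : 'I_i => M (w s))) : dsum X :=
  \sum_s dsum_inj (cs_val (k s)).
have [f fE] : bounded_operator (fun k : dsum (fun s : 'I_i => M (w s)) =>
    CsType (PN (S (emb k) i))).
  apply: (bounded_operator_corestr (f := fun k => P (S (emb k) i))).
  apply: bounded_operator_comp; first exact: bounded_operator_op.
  apply: (bounded_operator_comp (f := fun y : dsum X => y i)
    (g := fun k => S (emb k))).
    exact: bounded_operator_coord.
  apply: bounded_operator_comp; first exact: bounded_operator_op.
  apply: bounded_operator_sum => s.
  apply: bounded_operator_comp; first exact: bounded_operator_inj.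
  apply: bounded_operator_comp; first exact: bounded_operator_val.
  exact: bounded_operator_coord.
apply: (surjective_quot_range_finite_dim (T := f)); last exact: inf.
move=> [v vN].
(* Row [i] of [T (dsum_inj v)] is [D i v = 0] and the lower rows vanish by triangularity, so the
   decomposition applies with [m = i]. *)
have [|x [k [TvE kM x0 k0]]] := @upper_triangular_complement i
  (T (dsum_inj v)) (ltnW (ltn_ord i)) hM.
  move=> j; rewrite leq_eqVlt => /predU1P[ij|ij]; last first.
    exact: upper_triangular_inj_gt.
  have <- : i = j by exact: val_inj.
  by rewrite upper_triangular_inj_diag; exact/eqP.
exists (fun s => CsType (kM (w s) (ltn_ord s))).
rewrite fE; apply: val_inj => /=.
have -> : emb (fun s => CsType (kM (w s) (ltn_ord s))) = k.
  apply: functional_extensionality_dep => j; rewrite /emb dsum_sumE /=.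
  have [ji|ij] := ltnP j i; last first.
    rewrite k0// big1// => s _; rewrite dsum_inj_out// neq_ltn.
    by rewrite (leq_trans (ltn_ord s)).
  have -> : j = w (Ordinal ji) by exact: val_inj.
  rewrite (bigD1 (Ordinal ji))//= dsum_inj_in big1 ?addr0// => s sj.
  by rewrite dsum_inj_out.
(* Applying [S] gives [dsum_inj v = x + S k]. As [x i = 0], coordinate [i] reads [v = S k i], and
   [P] fixes [v]. *)
have := TS (dsum_inj v); rewrite TvE linearD /= TS => /(congr1 (@^~ i)) /=.
by rewrite dsum_addE x0// add0r dsum_inj_in => ->; exact: PK.
Qed.

End UpperTriangularLeftInverse.

Theorem theorem2p1 (R : realType) (n : nat)
  (X : 'I_n.+2 -> completeNormedModType R[i])
  (D : forall i, 'B(X i, X i))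
  (Kc : forall i, closedSubspace (X i))
  (hKc : forall i, complemented (closure (range (D i))) ->
    topological_complement (closure (range (D i))) (Kc i))
  (hreg : forall s : 'I_n.+2, (0 < s < n.+1)%N -> regular (D s)) :
  let stmt_i :=
    left_invertible (D ord0) /\
    (regular (D ord_max) /\
     forall i j : 'I_n.+2, i = j.+1 :> nat -> preceq (kernel (D i)) (Kc j)) in
  let stmt_ii :=
    exists A : strict_upper X, left_invertible (upper_triangular_op D A) in
  let stmt_iii :=
    left_invertible (D ord0) /\
    forall i : 'I_n.+2, (0 < i)%N ->
      ~ prec (dsum (fun s : 'I_i => Kc (widen_ord (ltnW (ltn_ord i)) s)))
             (kernel (D i)) in
  (stmt_i -> stmt_ii) /\
  ((forall i, is_hilbert (X i) /\ infinite_dim (X i)) ->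
   stmt_ii -> stmt_iii).
Proof.
move=> stmt_i stmt_ii stmt_iii.
have compl s : regular (D s) -> topological_complement (range (D s)) (Kc s).
  by move=> rs; apply: regular_topological_complement rs (hKc s).
(* Index 0 is regular because [D ord0] is left invertible, the intermediate indices by [hreg]. Only
   [ord_max] is left out. *)
have regD (s : 'I_n.+2) :
    left_invertible (D ord0) -> (s < n.+1)%N -> regular (D s).
  move=> D0 sn; have [s0|s0] := posnP s.
    have -> : s = ord0 by exact: val_inj.
    exact: left_invertible_regular.
  by apply: hreg; rewrite s0.
split.
  move=> [D0 [Dn hle]].
  have rD s : regular (D s).
    have := ltn_ord s; rewrite ltnS leq_eqVlt => /predU1P[sn|].
      by have -> : s = ord_max by exact: val_inj.
    exact: regD.
  by apply: (left_invertible_completion D0 rD) hle => s; exact: compl.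
move=> hX [A TA].
have D0 := upper_triangular_left_invertible_corner TA.
split=> // i _.
have [[dot dotE] _] := hX i.
have [P [PN PK]] := hilbert_projection dotE (kernel (D i)).
apply: (upper_triangular_left_invertible_not_prec PN PK _ TA) => s si.
(* A row [s < i] is never the last one, so [regD] covers it. *)
by apply/compl/regD => //; rewrite (leq_trans si)// -ltnS.
Qed.
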